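(* Let $R$ be a continuous and nonsingular ring. Suppose that $R$ satisfies ACC on left annihilators. Then $R$ is a semiprime left Goldie ring.
   Context: $R$ is an associative ring with unity; ''continuous'' and ''nonsingular'' refer to $R$ as a left $R$-module. A module $M$ is continuous if (C1) every submodule of $M$ is essential in a direct summand of $M$, and (C2) every submodule of $M$ that is isomorphic to a direct summand of $M$ is itself a direct summand. $R$ is left Goldie if it satisfies ACC on left annihilators and has finite uniform dimension as a left $R$-module. *)

(* Defs.v *)
From mathcomp Require Import all_boot all_order all_algebra.
From mathcomp Require Import boolp classical_sets functions cardinality.

Set Implicit Arguments.
Unset Strict Implicit.
Unset Printing Implicit Defensive.

Import GRing.Theory.
Local Open Scope ring_scope.
Local Open Scope classical_set_scope.

Section Modules.
Variables (R : pzRingType) (M : lmodType R).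
Implicit Types N D K U : set M.

Definition is_submodule N : Prop :=
  [/\ N 0, forall x y, N x -> N y -> N (x + y)
         & forall (a : R) x, N x -> N (a *: x)].

Definition essential_in N D : Prop :=
  [/\ is_submodule N, is_submodule D, N `<=` D
    & forall K, is_submodule K -> K `<=` D -> K <> [set 0] ->
        N `&` K <> [set 0]].

Definition direct_summand D : Prop :=
  is_submodule D /\
  exists E : set M, [/\ is_submodule E, D `&` E = [set 0]
    & forall x, exists d e, [/\ D d, E e & x = d + e]].

(* A homomorphism defined on N is encoded by a total function f on M, of which
   only the values on N matter. *)
Definition isomorphic_submodules N D : Prop :=
  exists f : M -> M,
    (forall (a : R) x y, N x -> N y -> f (a *: x + y) = a *: f x + f y) /\
    set_bij N D f.

Definition C1 : Prop :=
  forall N, is_submodule N -> exists D, direct_summand D /\ essential_in N D.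

Definition C2 : Prop :=
  forall N D, is_submodule N -> direct_summand D ->
    isomorphic_submodules N D -> direct_summand N.

Definition continuous_module : Prop := C1 /\ C2.

Definition uniform_submodule U : Prop :=
  [/\ is_submodule U, U <> [set 0]
    & forall K L : set M, is_submodule K -> is_submodule L ->
        K `<=` U -> L `<=` U -> K <> [set 0] -> L <> [set 0] ->
        K `&` L <> [set 0]].

Definition independent_family n (V : 'I_n -> set M) : Prop :=
  forall v : 'I_n -> M, (forall i, V i (v i)) ->
    \sum_i v i = 0 -> forall i, v i = 0.

Definition sum_family n (V : 'I_n -> set M) : set M :=
  [set x | exists v : 'I_n -> M, (forall i, V i (v i)) /\ x = \sum_i v i].

Definition has_uniform_dimension n : Prop :=
  exists V : 'I_n -> set M,
    [/\ forall i, uniform_submodule (V i), independent_family V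
      & essential_in (sum_family V) setT].

Definition finite_uniform_dimension : Prop :=
  exists n, has_uniform_dimension n.

End Modules.

Section Singular.
Variables (R : pzRingType) (M : lmodType R).

Definition annihilator_elt (m : M) : set R^o := [set r : R | r *: m = 0].

Definition singular_submodule : set M :=
  [set m | essential_in (annihilator_elt m) setT].

Definition nonsingular_module : Prop := singular_submodule = [set 0].

End Singular.

Arguments continuous_module {R} M.
Arguments finite_uniform_dimension {R} M.
Arguments nonsingular_module {R} M.

Section Rings.
Variable R : pzRingType.

Definition left_annihilator (X : set R) : set R :=
  [set r | forall x, X x -> r * x = 0].

Definition is_left_annihilator (I : set R) : Prop :=
  exists X : set R, I = left_annihilator X.

Definition acc_left_annihilators : Prop :=
  forall I : nat -> set R,
    (forall k, is_left_annihilator (I k)) ->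
    (forall k, I k `<=` I k.+1) ->
    exists n, forall m, (n <= m)%N -> I m = I n.

Definition left_goldie : Prop :=
  acc_left_annihilators /\ finite_uniform_dimension R^o.

Definition two_sided_ideal (I : set R) : Prop :=
  [/\ I 0, forall x y, I x -> I y -> I (x + y)
         & forall r x, I x -> I (r * x) /\ I (x * r)].

(* I^n is additively generated by the products of n elements of I, so I^n = 0
   means that all these products vanish. *)
Definition nilpotent_ideal (I : set R) : Prop :=
  exists n, forall x : 'I_n -> R, (forall i, I (x i)) -> \prod_i x i = 0.

Definition semiprime_ring : Prop :=
  forall I, two_sided_ideal I -> nilpotent_ideal I -> I = [set 0].

End Rings.

Arguments acc_left_annihilators : clear implicits.
Arguments left_goldie : clear implicits.
Arguments semiprime_ring : clear implicits.

(* Main.v *)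
Require Import Defs.
From mathcomp Require Import all_boot all_order all_algebra.
From mathcomp Require Import boolp classical_sets functions cardinality.

Import GRing.Theory.
Local Open Scope ring_scope.

(** Write l(a) for the left annihilator of an element a.  The theorem rests on
    Utumi's observation that a left continuous, left nonsingular ring is von
    Neumann regular: every a satisfies a = a x a for some x.  By C1, l(a) is
    essential in a direct summand D of R; by nonsingularity a left annihilator
    has no proper essential extension, so l(a) = D.  A complement E of l(a) is
    mapped bijectively onto Ra by right multiplication by a, so C2 makes Ra a
    direct summand, and splitting 1 along it gives x ([continuous_regular]).

    A regular ring is semiprime, because a = a x a = (a x)^n a for every n, and
    a x lies in every ideal that contains a ([regular_semiprime]).

    For the uniform dimension, order the idempotents by f <= e iff
    e f = f e = f.  Along a strictly decreasing sequence of idempotents the left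
    annihilators increase strictly, so the chain condition allows well-founded
    induction on idempotents ([idempotent_ind]).  Splitting an idempotent that
    is neither zero nor primitive as f + (e - f), this induction writes 1 as a
    finite sum of orthogonal primitive idempotents e_i
    ([idempotent_decomposition]).  In a regular ring every R e_i is a simple
    left ideal ([primitive_simple]), hence uniform, and R is the direct sum of
    the R e_i. *)

(** * Submodules and essential extensions *)

Lemma submodule_neq0P (R : pzRingType) (M : lmodType R) (N : set M) :
  is_submodule N -> N <> [set 0]%classic <-> exists2 x, N x & x <> 0.
Proof.
move=> [N0 _ _]; split=> [Nn0|[x Nx xn0] N_0]; last by move: Nx; rewrite N_0.
apply: contrapT => noN; apply: Nn0; apply/seteqP; split=> [x Nx|x -> //].
by apply: contrapT => xn0; apply: noN; exists x.
Qed.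

Lemma submodule_setT (R : pzRingType) (M : lmodType R) :
  is_submodule (@setT M).
Proof. by []. Qed.

Lemma submodule_setI (R : pzRingType) (M : lmodType R) (N K : set M) :
  is_submodule N -> is_submodule K -> is_submodule (N `&` K)%classic.
Proof.
move=> [N0 ND NZ] [K0 KD KZ]; split=> //.
  by move=> x y [Nx Kx] [Ny Ky]; split; [exact: ND|exact: KD].
by move=> a x [Nx Kx]; split; [exact: NZ|exact: KZ].
Qed.

Lemma submodule_colon (R : pzRingType) (M : lmodType R) (N : set M) (d : M) :
  is_submodule N -> @is_submodule R R^o [set r : R | N (r *: d)]%classic.
Proof.
move=> [N0 ND NZ]; split=> /=.
- by rewrite scale0r.
- by move=> x y Nx Ny; rewrite scalerDl; exact: ND.
- by move=> a x Nx; rewrite -scalerA; exact: NZ.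
Qed.

Lemma submodule_scale (R : pzRingType) (M : lmodType R) (K : set R^o) (d : M) :
  is_submodule K ->
  is_submodule [set y : M | exists2 k : R, K k & y = k *: d]%classic.
Proof.
move=> [K0 KD KZ]; split=> /=.
- by exists 0; rewrite // scale0r.
- move=> _ _ [k Kk ->] [l Kl ->].
  by exists (k + l); rewrite ?scalerDl //; exact: KD.
- by move=> a _ [k Kk ->]; exists (a * k); rewrite ?scalerA //; exact: KZ.
Qed.

(** Essentiality pulls back along r |-> r *: d: a left ideal K is either killed
    by d, and then contained in the preimage, or has a nonzero image K d, which
    meets N. *)
Lemma essential_colon (R : pzRingType) (M : lmodType R) (N D : set M) (d : M) :
  essential_in N D -> D d ->
  @essential_in R R^o [set r : R | N (r *: d)]%classic setT.
Proof.
move=> [subN subD _ essN] Dd; have subC := submodule_colon _ _ _ d subN.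
split=> // K subK _ /(submodule_neq0P _ _ _ subK)[k Kk kn0].
apply/submodule_neq0P; first exact: submodule_setI.
have subKd := submodule_scale _ _ _ d subK.
have [[l Kl ldn0]|Kd0] := pselect (exists2 l : R, K l & l *: d <> 0).
- have : (N `&` [set y | exists2 k : R, K k & y = k *: d] <> [set 0])%classic.
    apply: essN => //; first by case: subD => _ _ DZ _ [m _ ->]; exact: DZ.
    by apply/submodule_neq0P => //; exists (l *: d) => //; exists l.
  move=> /submodule_neq0P[|y [Ny [m Km yE]]]; first exact: submodule_setI.
  rewrite yE in Ny * => mdn0.
  by exists m => // m0; apply: mdn0; rewrite m0 scale0r.
- exists k => //; split=> //=.
  have -> : (k : R) *: d = 0 by apply: contrapT => kdn0; apply: Kd0; exists k.
  by case: subN.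
Qed.

(** An annihilator in a nonsingular module is essentially closed: if d lies in
    an essential extension of the annihilator of m, then d *: m is killed by an
    essential left ideal. *)
Lemma annihilator_closed (R : pzRingType) (M : lmodType R) (m : M)
    (D : set R^o) :
  nonsingular_module M -> essential_in (annihilator_elt m) D ->
  annihilator_elt m = D.
Proof.
move=> nonsM essD; apply/seteqP; split; first by case: essD.
move=> d Dd; have : singular_submodule ((d : R) *: m).
  have := essential_colon _ _ _ _ d essD Dd; rewrite /singular_submodule /=.
  congr (essential_in _ _); apply/seteqP; split=> r; rewrite /annihilator_elt /=;
    by rewrite scalerA.
by rewrite nonsM.
Qed.

(** * Von Neumann regular rings *)

Definition regular_ring (R : pzRingType) : Prop :=
  forall a : R, exists x, a = a * x * a.

(** Write 1 = x a + f with f in a complement F of Ra.  Then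
    a f = a - a x a lies both in F and in Ra. *)
Lemma summand_regular (R : pzRingType) (a : R) :
  @direct_summand R R^o [set y : R | exists r : R, y = r * a]%classic ->
  exists x, a = a * x * a.
Proof.
move=> [_ [F [[_ _ FZ] RaF split1]]].
have [_ [f [[x ->] Ff eq1]]] := split1 1.
have af_eq : a * f = a - a * x * a.
  by rewrite -[X in X - _]mulr1 eq1 mulrDr mulrA addrC addKr.
exists x; apply/eqP; rewrite -subr_eq0 -af_eq; apply/eqP.
have : ([set y | exists r, y = r * a] `&` F)%classic (a * f).
  split; last exact: (FZ a f Ff).
  by exists (1 - a * x); rewrite mulrBl mul1r.
by rewrite RaF.
Qed.

(** Right multiplication by a maps a complement of the kernel l(a) bijectively
    onto Ra; the isomorphism required is its inverse. *)
Lemma complement_iso (R : pzRingType) (a : R) (E : set R^o) :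
  is_submodule E -> (@annihilator_elt R R^o a `&` E = [set 0])%classic ->
  (forall x : R^o, exists d e : R^o,
     [/\ @annihilator_elt R R^o a d, E e & x = d + e]) ->
  @isomorphic_submodules R R^o [set y : R | exists r : R, y = r * a]%classic E.
Proof.
move=> [E0 ED EZ] annE split1.
have inj_a e1 e2 : E e1 -> E e2 -> e1 * a = e2 * a -> e1 = e2.
  move=> Ee1 Ee2 eq12; apply/eqP; rewrite -subr_eq0; apply/eqP.
  have : (@annihilator_elt R R^o a `&` E)%classic (e1 - e2).
    split; first by rewrite /annihilator_elt /= [LHS]mulrBl eq12 subrr.
    by apply: ED => //; rewrite -scaleN1r; exact: EZ.
  by rewrite annE.
have surj_a y : exists e : R, (exists r : R, y = r * a) -> E e /\ e * a = y.
  have [[r ->]|noy] := pselect (exists r : R, y = r * a); last first.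
    by exists 0 => /noy.
  have [d [e [da0 Ee ->]]] := split1 r; exists e => _; split=> //.
  by rewrite mulrDl [d * a]da0 add0r.
have [g gP] := choice surj_a.
exists g; split=> [c x y Nx Ny|].
  have [Ex gx] := gP x Nx; have [Ey gy] := gP y Ny.
  have [Ez gz] : E (g (c * x + y)) /\ g (c * x + y) * a = c * x + y.
    apply: gP; case: Nx Ny => r -> [s ->].
    by exists (c * r + s); rewrite mulrDl mulrA.
  apply: inj_a => //; first by apply: ED => //; exact: EZ.
  by rewrite [LHS]gz [RHS](mulrDl (c * g x)) gy -mulrA gx.
split.
- by move=> y /gP[].
- move=> y z; rewrite !inE => /gP[_ gy] /gP[_ gz] gyz.
  by rewrite -gy gyz gz.
- move=> e Ee; exists (e * a); first by exists e.
  have [Eg ge] : E (g (e * a)) /\ g (e * a) * a = e * a by apply: gP; exists e.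
  exact: inj_a.
Qed.

Lemma continuous_regular (R : pzRingType) :
  continuous_module R^o -> nonsingular_module R^o -> regular_ring R.
Proof.
move=> [hC1 hC2] nonsR a; apply: summand_regular.
have sub_ann : is_submodule (@annihilator_elt R R^o a).
  apply: (@submodule_colon R R^o [set 0]%classic a); split=> //=.
  - by move=> x y -> ->; rewrite addr0.
  - by move=> c x ->; rewrite scaler0.
have [D [sumD essD]] := hC1 _ sub_ann.
move: sumD; rewrite -(annihilator_closed _ _ _ _ nonsR essD).
move=> [_ [E [subE annE split1]]].
apply: (hC2 _ E); last exact: complement_iso.
- have := @submodule_scale R R^o setT a (submodule_setT _ _).
  congr is_submodule; apply/seteqP.
  by split=> y [r]; [move=> _ ->; exists r|exists r].
- split=> //; exists (annihilator_elt (a : R^o)); split=> //; first by rewrite setIC.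
  by move=> x; have [d [e [Dd Ee ->]]] := split1 x; exists e, d; rewrite addrC.
Qed.

Lemma regular_semiprime (R : pzRingType) : regular_ring R -> semiprime_ring R.
Proof.
move=> regR I [I0 _ IM] [n nilI]; apply/seteqP; split=> [a Ia|_ -> //] /=.
have [x ax] := regR a.
have powE k : a = (a * x) ^+ k * a.
  by elim: k => [|k IHk]; rewrite ?mul1r // exprSr -mulrA -ax.
have := nilI (fun=> a * x); rewrite prodr_const card_ord => axn0.
by rewrite (powE n) axn0 ?mul0r // => _; exact: (IM x a Ia).2.
Qed.

(** * Orthogonal decompositions of idempotents *)

Definition idempotent_le (R : pzRingType) (f e : R) : Prop :=
  e * f = f /\ f * e = f.

Definition idempotent_elt (R : pzRingType) (e : R) : Prop := e * e = e.

Definition primitive_idempotent (R : pzRingType) (e : R) : Prop :=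
  [/\ idempotent_elt R e, e <> 0
    & forall f, idempotent_elt R f -> idempotent_le R f e -> f <> 0 -> f = e].

(** A counterexample would yield a strictly decreasing sequence e_k of
    idempotents.  The left annihilators of the e_k increase, and when they
    stabilize 1 - e_(k+1) kills e_k, so that e_k = e_(k+1). *)
Lemma idempotent_ind (R : pzRingType) (P : R -> Prop) :
  acc_left_annihilators R ->
  (forall e, idempotent_elt R e ->
     (forall f, idempotent_elt R f -> idempotent_le R f e -> f <> e -> P f) ->
     P e) ->
  forall e, idempotent_elt R e -> P e.
Proof.
move=> accR stepP e0 id0; apply: contrapT => nPe0.
pose bad e := idempotent_elt R e /\ ~ P e.
have next e : exists f, bad e -> [/\ bad f, idempotent_le R f e & f <> e].
  have [[ide nPe]|nbad] := pselect (bad e); last by exists 0 => /nbad.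
  apply: contrapT => noex; apply: nPe; apply: stepP => // f idf lefe fne.
  by apply: contrapT => nPf; apply: noex; exists f.
have [g gP] := choice next.
pose u k := iter k g e0.
have badu k : bad (u k) by elim: k => [//|k /gP[]].
have [||n stab] := accR (fun k => left_annihilator [set u k]%classic).
- by move=> k; exists [set u k]%classic.
- move=> k r rann _ ->; have [_ [ug _] _] := gP _ (badu k).
  by rewrite -[u k.+1]ug mulrA rann // mul0r.
have [[idS _] [_ gu] gne] := gP _ (badu n); apply: gne.
have : left_annihilator [set u n.+1]%classic (1 - u n.+1).
  by move=> _ ->; rewrite mulrBl mul1r [u _ * u _]idS subrr.
rewrite (stab n.+1 (leqnSn n)) => /(_ (u n) erefl)/eqP.
by rewrite mulrBl mul1r subr_eq0 [u n.+1 * u n]gu => /eqP.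
Qed.

Definition orthogonal_primitives (R : pzRingType) n (e : 'I_n -> R) : Prop :=
  (forall i, primitive_idempotent R (e i)) /\
  (forall i j, i != j -> e i * e j = 0).

Lemma orthogonal_sum_absorb (R : pzRingType) n (e : 'I_n -> R) i :
  orthogonal_primitives R n e ->
  e i * (\sum_j e j) = e i /\ (\sum_j e j) * e i = e i.
Proof.
move=> [pe orthe]; have [idi _ _] := pe i.
rewrite mulr_sumr mulr_suml; split; rewrite (bigD1 i) //= idi big1 ?addr0 //.
  by move=> j ji; rewrite orthe // eq_sym.
by move=> j ji; rewrite orthe.
Qed.

Lemma orthogonal_primitives_cat (R : pzRingType) m n (e : 'I_m -> R)
    (f : 'I_n -> R) :
  orthogonal_primitives R m e -> orthogonal_primitives R n f ->
  (\sum_i e i) * (\sum_j f j) = 0 -> (\sum_j f j) * (\sum_i e i) = 0 ->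
  exists g : 'I_(m + n) -> R,
    orthogonal_primitives R _ g /\
    \sum_k g k = \sum_i e i + \sum_j f j.
Proof.
move=> He Hf ef0 fe0.
pose g k := match fintype.split k with inl i => e i | inr j => f j end.
have gl i : g (lshift n i) = e i by rewrite /g (unsplitK (inl i)).
have gr j : g (rshift m j) = f j by rewrite /g (unsplitK (inr j)).
exists g; split; last first.
  rewrite big_split_ord /=.
  by congr (_ + _); apply: eq_bigr => i _; rewrite ?gl ?gr.
(* e i f j = e i (sum e) (sum f) f j, and symmetrically *)
have eifj i j : e i * f j = 0.
  rewrite -(orthogonal_sum_absorb _ _ _ i He).1.
  rewrite -(orthogonal_sum_absorb _ _ _ j Hf).2.
  by rewrite -mulrA [X in _ * X]mulrA ef0 mul0r mulr0.
have fjei i j : f j * e i = 0.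
  rewrite -(orthogonal_sum_absorb _ _ _ j Hf).1.
  rewrite -(orthogonal_sum_absorb _ _ _ i He).2.
  by rewrite -mulrA [X in _ * X]mulrA fe0 mul0r mulr0.
case: He Hf => pe oe [pf ortf]; split=> [k|k l].
  by case: (split_ordP k) => i ->; rewrite ?gl ?gr.
case: (split_ordP k) => i ->; case: (split_ordP l) => j ->; rewrite ?gl ?gr //.
  by rewrite eq_lshift => /oe.
by rewrite eq_rshift => /ortf.
Qed.

Lemma idempotent_decomposition (R : pzRingType) (e : R) :
  acc_left_annihilators R -> idempotent_elt R e ->
  exists n (f : 'I_n -> R), orthogonal_primitives R n f /\ \sum_i f i = e.
Proof.
move=> accR; move: e; apply: idempotent_ind => // e ide IH.
have [->|en0] := pselect (e = 0).
  exists 0, (fun=> 0); split; last by rewrite big_ord0.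
  by split; case.
have [pe|npe] := pselect (primitive_idempotent R e).
  exists 1, (fun=> e); split; last by rewrite big_ord1.
  by split=> // i j; rewrite !ord1.
have [f [idf [ef fe] fn0 fne]] : exists f, [/\ idempotent_elt R f,
    idempotent_le R f e, f <> 0 & f <> e].
  apply: contrapT => noex; apply: npe; split=> // f idf lefe fn0.
  by apply: contrapT => fne; apply: noex; exists f.
have [m [u [Hu sumu]]] := IH f idf (conj ef fe) fne.
have idef : idempotent_elt R (e - f).
  by rewrite /idempotent_elt mulrBr !mulrBl ide idf ef fe subrr subr0.
have [||n [v [Hv sumv]]] := IH (e - f) idef.
- by rewrite /idempotent_le mulrBr mulrBl ide ef fe.
- by move/eqP; rewrite -subr_eq0 addrC addKr oppr_eq0 => /eqP.
have [||w [Hw sumw]] := orthogonal_primitives_cat R _ _ u v Hu Hv.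
- by rewrite sumu sumv mulrBr idf fe subrr.
- by rewrite sumu sumv mulrBl idf ef subrr.
by exists (m + n)%N, w; split=> //; rewrite sumw sumu sumv addrC subrK.
Qed.

(** * Finite uniform dimension *)

Definition principal_left_ideal (R : pzRingType) (e : R) : set R^o :=
  [set r : R | exists s : R, r = s * e]%classic.

(** If b = b x b lies in Re, then b e = b, so e x b is an idempotent below e;
    it is nonzero because b (e x b) = b.  Primitivity forces it to be e, which
    therefore lies in Rb. *)
Lemma primitive_simple (R : pzRingType) (e b : R) :
  regular_ring R -> primitive_idempotent R e ->
  principal_left_ideal R e b -> b <> 0 -> exists r, e = r * b.
Proof.
move=> regR [ide _ mine] [s bE] bn0; have [x bx] := regR b.
have be : b * e = b by rewrite bE -mulrA ide.
exists (e * x); symmetry; apply: mine.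
- rewrite /idempotent_elt.
  by rewrite -!mulrA [b * (e * _)]mulrA be [b * (x * b)]mulrA -bx.
- by split; [rewrite !mulrA ide|rewrite -mulrA be].
- move=> exb0; apply: bn0.
  have -> : b = b * (e * x * b) by rewrite !mulrA be.
  by rewrite exb0 mulr0.
Qed.

Lemma primitive_uniform (R : pzRingType) (e : R) :
  regular_ring R -> primitive_idempotent R e ->
  uniform_submodule (principal_left_ideal R e).
Proof.
move=> regR pe; have [ide en0 _] := pe.
have subRe : is_submodule (principal_left_ideal R e).
  split.
  - by exists 0; rewrite mul0r.
  - by move=> _ _ [s ->] [t ->]; exists (s + t); rewrite mulrDl.
  - by move=> a _ [s ->]; exists (a * s); rewrite -mulrA.
have in_e (K : set R^o) : is_submodule K ->
    (K `<=` principal_left_ideal R e -> K <> [set 0] -> K e)%classic.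
  move=> subK KRe /submodule_neq0P[//|b Kb bn0].
  have [r ->] := primitive_simple R e b regR pe (KRe b Kb) bn0.
  by case: subK => _ _; exact.
split=> //.
  by apply/submodule_neq0P => //; exists e => //; exists e; rewrite ide.
move=> K L subK subL KRe LRe Kn0 Ln0.
apply/submodule_neq0P; first exact: submodule_setI.
by exists e => //; split; exact: in_e.
Qed.

Lemma finite_uniform_dimension_of_primitives (R : pzRingType) n (e : 'I_n -> R) :
  regular_ring R -> orthogonal_primitives R n e -> \sum_i e i = 1 ->
  finite_uniform_dimension R^o.
Proof.
move=> regR [pe oe] sume; exists n, (fun i => principal_left_ideal R (e i)).
have sumT : sum_family (fun i => principal_left_ideal R (e i)) = setT.
  apply/seteqP; split=> // x _; exists (fun i => x * e i); split.
    by move=> i; exists x.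
  by rewrite -[LHS]mulr1 -sume mulr_sumr.
split.
- by move=> i; exact: primitive_uniform.
- move=> v vP sumv i.
  have ve j k : v j * e k = if j == k then v j else 0.
    have [s ->] := vP j; rewrite -mulrA.
    by have [<-|/oe ->] := eqVneq j k; [case: (pe j) => ->|rewrite mulr0].
  have /eqP : (\sum_j v j) * e i = 0 by rewrite [X in X * _]sumv mul0r.
  rewrite [X in X == _]mulr_suml (bigD1 i) //= big1 ?addr0 ?ve ?eqxx => [/eqP //|].
  by move=> j ji; rewrite ve (negbTE ji).
- by rewrite sumT; split=> // K _ _; rewrite setTI.
Qed.

Theorem corollary3p7 (R : pzRingType)
    (hcont : continuous_module R^o)
    (hnons : nonsingular_module R^o)
    (hacc : acc_left_annihilators R) :
  semiprime_ring R /\ left_goldie R.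
Proof.
have regR := continuous_regular R hcont hnons.
split; first exact: regular_semiprime.
split=> //.
have [n [e [oe sume]]] := idempotent_decomposition R 1 hacc (mulr1 1).
exact: (finite_uniform_dimension_of_primitives R n e).
Qed.
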